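(* Let $S$ be a set and $x:S\to S$ a map. Then the condition $$x\Bigl(\bigcap_{n\ge 0}x^n(S)\Bigr)=\bigcap_{n\ge 0}x^n(S)$$ is necessary and sufficient for $x$ to have a strong inner inverse $y$ in the monoid of all maps $S\to S$ (under composition).
   Context: For elements $x,y$ of a monoid $M$, $y$ is called a strong inner inverse to $x$ (in $M$) if $x^i y^j x^k = y^{j-i}x^j y^{j-k}$ for all integers $i,j,k$ with $0\le i\le j$ and $0\le k\le j$. Maps are written on the left of their arguments and composed accordingly. *)

(* Defs.v *)
From HB Require Import structures.
From mathcomp Require Import all_boot.
From mathcomp Require Import boolp classical_sets.

Set Implicit Arguments.
Unset Strict Implicit.
Unset Printing Implicit Defensive.

Local Open Scope group_scope.

Definition strong_inner_inverse (M : monoidType) (x y : M) : Prop :=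
  forall i j k : nat, i <= j -> k <= j ->
    x ^+ i * y ^+ j * x ^+ k = y ^+ (j - i) * x ^+ j * y ^+ (j - k).

(* An alias of S -> S, so that the composition monoid structure is not attached
   to every arrow type. Products are [f * g = f \o g]. *)
Definition selfmap (S : Type) : Type := S -> S.

Section SelfmapMonoid.
Variable S : Type.
Implicit Types f g h : selfmap S.

Let compmap f g : selfmap S := f \o g.
Let idmap : selfmap S := id.

Let compmapA : associative compmap. Proof. by []. Qed.
Let compidmap : left_id idmap compmap. Proof. by []. Qed.
Let compmapid : right_id idmap compmap. Proof. by []. Qed.

HB.instance Definition _ := gen_eqMixin (selfmap S).
HB.instance Definition _ := gen_choiceMixin (selfmap S).
HB.instance Definition _ :=
  isMonoid.Build (selfmap S) compmapA compidmap compmapid.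

Lemma selfmap_mulE f g : f * g = f \o g. Proof. by []. Qed.

Lemma selfmap_oneE : 1 = id :> selfmap S. Proof. by []. Qed.

Lemma selfmap_expE f n : f ^+ n = iter n f.
Proof.
by apply/funext; elim: n => [|n IHn] s //; rewrite expgS selfmap_mulE /= IHn.
Qed.

End SelfmapMonoid.

(* Main.v *)
Require Import Defs.
From mathcomp Require Import all_boot.
From mathcomp Require Import boolp classical_sets.

Local Open Scope classical_set_scope.

(** Write [D n] for the image of [x ^ n], and say that a point of [D n] has
depth at least [n].  The condition of the theorem says that each point of
infinite depth has a preimage of infinite depth.

Necessity: the relation with [i = n], [j = k = n + 1] reads
[x^n y^(n+1) x^(n+1) = y x^(n+1)], so [y] sends [D (n + 1)] into [D n].  Hence
[y] preserves infinite depth, and [x y x = x] makes [y s] a preimage of [s].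

Sufficiency: all the relations follow from three families
([strong_inner_inverse_of_relations]).  If [x^n y^n] is the identity on [D n],
these families say that [y^m x^m y^m = y^m], that [y^m x^m] maps each [D n]
into itself, and that [x^m y^m] preserves the kernel of each [x ^ n].  On [D 1]
the map [y] picks a preimage whose depth is as large as possible, i.e. smaller
by at most one; this is where the condition on [x] enters
([exists_deep_preimage]).  The difficulty is to define [y] on a point [s]
outside [D 1].
- If some [x ^ k s] is deeper than is explained by its being the [k]-th
  iterate of [s], i.e. lies in [D (k + 1)], take the least such [k] and put
  [y s = y^(k+1) (x^k s)]: go up from [s] to the first point from which one can
  go down one step further than [s], and go down from there.
- Otherwise [s] is called stranded.  All stranded points are sent to a single
  stranded point [c], and the preimages picked on [D 1] are arranged so that
  [y] runs back along the orbit of [c], which gives [y^j x^j c = c].  No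
  conflict arises, because [x ^ j c] has depth exactly [j]: the points of the
  orbit are distinct, and each is as deep a preimage of the next one as
  possible.

With this choice [x^n u = x^n v] implies [x^(n+1) (y u) = x^(n+1) (y v)]
([depth_first_kernel]): if [x^n u] lies in [D (n + 1)], both sides equal
[x^n u]; if not, going up from [u] and going up from [v] stop at the same
point, or both [u] and [v] are stranded, so that [y u = y v].  Iterating this
gives the statement on kernels. *)

(** * Depth *)

Section PowerImages.
Context {S : Type}.
Variable x : S -> S.

Definition powim (n : nat) : set S := iter n x @` [set: S].

Lemma powim_iter n m s : powim n s -> powim (m + n) (iter m x s).
Proof. by move=> [t _ <-]; exists t; rewrite // iterD. Qed.

Lemma powim_le {m n s} : m <= n -> powim n s -> powim m s.
Proof.
by move=> le_mn [t _ <-]; exists (iter (n - m) x t); rewrite // -iterD subnKC.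
Qed.

(** Every iterate of [c] has exactly the depth that it owes to [c]. *)
Definition stranded (c : S) : Prop := forall k, ~ powim k.+1 (iter k x c).

Lemma stranded_depth c n j : stranded c -> powim n (iter j x c) -> n <= j.
Proof.
move=> cP Dn; rewrite leqNgt; apply/negP => lt_jn.
exact: (cP j (powim_le lt_jn Dn)).
Qed.

Lemma stranded_inj c i j : stranded c -> iter i x c = iter j x c -> i = j.
Proof.
move=> cP eq_ij; have Dx l : powim l (iter l x c) by exists c.
apply/eqP; rewrite eqn_leq; apply/andP; split; apply: stranded_depth cP _.
  by rewrite -eq_ij.
by rewrite eq_ij.
Qed.

(** A point of finite depth [n] is some [x ^ n t], and then [x ^ (n - 1) t] is
a deep preimage; a point of infinite depth needs the hypothesis. *)
Lemma exists_deep_preimage s :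
  x @` (\bigcap_(n in [set: nat]) powim n) = \bigcap_(n in [set: nat]) powim n ->
  powim 1 s -> exists2 t, x t = s & forall n, powim n.+1 s -> powim n t.
Proof.
move=> xcap D1; have [Dall|] := pselect (forall n, powim n s).
  have: (\bigcap_(n in [set: nat]) powim n) s by move=> n _; apply: Dall.
  by rewrite -xcap => -[t tP <-]; exists t => // n _; apply: tP.
move=> /existsNP exN.
have exb : exists n, ~~ `[< powim n s >].
  by have [n nP] := exN; exists n; apply/asboolP.
case: (ex_minnP exb) => m /asboolP NDm minm.
have Dlt n : n < m -> powim n s.
  move=> lt_nm; apply/asboolP; apply: contraLR lt_nm => /minm.
  by rewrite -leqNgt.
case: m NDm minm Dlt => [|[|m]] NDm minm Dlt; [by case: NDm; exists s | by [] |].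
have [//|t _ ts] := Dlt m.+1; exists (iter m x t) => // n Dn.
have le_nm : n <= m.
  rewrite leqNgt; apply/negP => lt_mn; apply: NDm.
  exact: powim_le _ Dn.
by apply: powim_le le_nm _; exists t.
Qed.

(** * The depth-first choice of [y] *)

(** The least [k] for which [x ^ k s] lies in [powim k.+1]; it is [0] exactly
when [s] has a preimage. *)
Definition first_ascent (s : S) (k : nat) : Prop :=
  powim k.+1 (iter k x s) /\ forall i, powim i.+1 (iter i x s) -> k <= i.

Lemma first_ascentP s : (exists k, first_ascent s k) \/ stranded s.
Proof.
have [[k kP]|Nk] := pselect (exists k, powim k.+1 (iter k x s)); last first.
  by right=> k Dk; apply: Nk; exists k.
left; have exb : exists k, `[< powim k.+1 (iter k x s) >].
  by exists k; apply/asboolP.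
case: (ex_minnP exb) => m /asboolP Dm minm; exists m; split=> // i Di.
by apply: minm; apply/asboolP.
Qed.

Lemma first_ascent_unique s k l : first_ascent s k -> first_ascent s l -> k = l.
Proof.
by move=> [Dk kP] [Dl lP]; apply/eqP; rewrite eqn_leq kP // lP.
Qed.

(** Stranded points need not exist, and [c] is then arbitrary.  The last field
is therefore required only when there is one; it does not mention that [c] is
stranded, since the relations use only that [c] is fixed by each
[y^j x^j]. *)
Record depth_first (y : S -> S) (c : S) : Prop := DepthFirst {
  df_section : forall s, powim 1 s -> x (y s) = s;
  df_deep : forall n s, powim n.+1 s -> powim n (y s);
  df_ascent : forall s k, first_ascent s k -> y s = iter k.+1 y (iter k x s);
  df_stranded : forall s, stranded s -> y s = c;
  df_orbit : forall s, stranded s -> forall j, iter j y (iter j x c) = c }.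

(** The two requirements on a preimage are compatible: [x ^ j.+1 c] has depth
exactly [j.+1], so that [x ^ j c] is a deep preimage of it, and [j] is
determined by the point. *)
Lemma exists_deep_section c :
  x @` (\bigcap_(n in [set: nat]) powim n) = \bigcap_(n in [set: nat]) powim n ->
  exists z : S -> S,
    [/\ forall s, powim 1 s -> x (z s) = s,
        forall n s, powim n.+1 s -> powim n (z s) &
        stranded c -> forall j, z (iter j.+1 x c) = iter j x c].
Proof.
move=> xcap.
have zP s : exists t, powim 1 s ->
    [/\ x t = s, forall n, powim n.+1 s -> powim n t &
        stranded c -> forall j, s = iter j.+1 x c -> t = iter j x c].
  have [D1|ND1] := pselect (powim 1 s); last by exists s.
  have [[j [cP sE]]|Nc] := pselect (exists j, stranded c /\ s = iter j.+1 x c).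
    exists (iter j x c) => _; split=> [//|n|_ i].
      rewrite {1}sE => /(stranded_depth _ _ _ cP) le_nj.
      by apply: (@powim_le n j) => //; exists c.
    by rewrite sE => /(stranded_inj _ _ _ cP) [->].
  have [t ts tD] := exists_deep_preimage s xcap D1.
  by exists t => _; split=> // cP j sE; case: Nc; exists j.
have [z zE] := choice zP; exists z; split.
- by move=> s /zE[].
- by move=> n s Dn; have [|_ + _] := zE s; [exact: powim_le _ Dn | exact].
- move=> cP j; have [|_ _] := zE (iter j.+1 x c); last exact.
  by exists (iter j x c).
Qed.

Lemma exists_depth_first (s0 : S) :
  x @` (\bigcap_(n in [set: nat]) powim n) = \bigcap_(n in [set: nat]) powim n ->
  exists y c, depth_first y c.
Proof.
move=> xcap.
have [c cP] : exists c, (exists s, stranded s) -> stranded c.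
  have [[c cP]|Nc] := pselect (exists s, stranded s); first by exists c.
  by exists s0.
have [z [zx zD zc]] := exists_deep_section c xcap.
have yP s : exists t,
    (forall k, first_ascent s k -> t = iter k.+1 z (iter k x s)) /\
    (stranded s -> t = c).
  have [[k kP]|sP] := first_ascentP s.
    exists (iter k.+1 z (iter k x s)).
    split=> [l /(first_ascent_unique s k l kP) <- //|].
    by move=> sP; case: (sP k); case: kP.
  by exists c; split=> // k [/sP].
have [y yE] := choice yP; exists y, c.
have yz s : powim 1 s -> y s = z s.
  by move=> D1; have [/(_ 0) -> //] := yE s; split.
have yzn n s : powim n s -> iter n y s = iter n z s.
  elim: n s => // n IHn s Dn; rewrite !iterSr yz ?IHn //; first exact: zD.
  exact: powim_le _ Dn.
split.
- by move=> s D1; rewrite yz // zx.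
- by move=> n s Dn; rewrite yz; [exact: zD | exact: powim_le _ Dn].
- by move=> s k kP; have [/(_ k kP) -> _] := yE s; rewrite yzn //; case: kP.
- by move=> s sP; have [_ ->] := yE s.
- move=> s sP; have {}cP : stranded c by apply: cP; exists s.
  elim=> // j IHj; rewrite iterSr yz ?zc //.
  by exists (iter j x c).
Qed.

(** * Properties of the depth-first choice *)

Section DepthFirst.
Variables (y : S -> S) (c : S).
Hypothesis yP : depth_first y c.

Lemma depth_first_deep n m s : powim (n + m) s -> powim m (iter n y s).
Proof.
elim: n s => // n IHn s Dn; rewrite iterSr; apply: IHn.
exact: (df_deep _ _ yP).
Qed.

Lemma depth_first_iterK n s : powim n s -> iter n x (iter n y s) = s.
Proof.
elim: n s => // n IHn s Dn; rewrite iterS iterSr IHn.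
  by apply: (df_section _ _ yP); apply: powim_le _ Dn.
exact: (df_deep _ _ yP).
Qed.

(** The first ascent of [s] comes no later than [n]; above it, the powers of
[y] in the definition of [y s] are sections of those of [x]. *)
Lemma depth_first_ascend n s :
  powim n.+1 (iter n x s) -> iter n.+1 x (y s) = iter n x s.
Proof.
move=> Dn; have [[k kP]|/(_ n)//] := first_ascentP s.
have [Dk /(_ n Dn) le_kn] := kP.
rewrite (df_ascent _ _ yP s k kP) -(subnK le_kn) -addnS.
by rewrite iterD depth_first_iterK // -iterD.
Qed.

(** This is why [y] depends on [s] only through the first ascent, and why all
stranded points must share one image. *)
Lemma depth_first_kernel n u v :
  iter n x u = iter n x v -> iter n.+1 x (y u) = iter n.+1 x (y v).
Proof.
move=> uv; have [Dn|NDn] := pselect (powim n.+1 (iter n x u)).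
  by rewrite !depth_first_ascend -?uv.
have tail a k : iter n x a = iter n x u ->
    powim k.+1 (iter k x a) -> n < k.
  move=> au Dk; rewrite ltnNge; apply/negP => le_kn; apply: NDn.
  by rewrite -au -(subnK le_kn) -addnS iterD; apply: powim_iter.
have eqx k : n <= k -> iter k x u = iter k x v.
  by move=> le_nk; rewrite -(subnK le_nk) !iterD uv.
(* No ascent starts before step [n], and from there on the orbits agree. *)
have Duv k : powim k.+1 (iter k x u) <-> powim k.+1 (iter k x v).
  split=> Dk; first by rewrite -eqx // ltnW // (tail u).
  by rewrite eqx // ltnW // (tail v).
congr (iter _ x _); have [[k kP]|uP] := first_ascentP u.
  have kP' : first_ascent v k.
    by case: kP => Dk kmin; split=> [|i /Duv]; [exact/Duv | exact: kmin].
  rewrite (df_ascent _ _ yP u k kP) (df_ascent _ _ yP v k kP') eqx //.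
  by apply/ltnW/(tail u) => //; case: kP.
by rewrite !(df_stranded _ _ yP) // => k /Duv; apply: uP.
Qed.

Lemma depth_first_iter_kernel m n u v : iter n x u = iter n x v ->
  iter (n + m) x (iter m y u) = iter (n + m) x (iter m y v).
Proof.
elim: m n u v => [|m IHm] n u v uv; first by rewrite addn0.
by rewrite addnS -addSn ![iter m.+1 y _]iterSr; apply: IHm; apply: depth_first_kernel.
Qed.

(** By induction on [j]: let [s' = y^j s], with first ascent at [k].  Then
[y s' = y^(k+1) (x^k s')], and in [x^(j+1) y^(k+1)] the shorter of the two powers
cancels. If [x^(j+1)] is the longer one, what remains is the case of [j]. *)
Lemma depth_first_inner j s : iter j y (iter j x (iter j y s)) = iter j y s.
Proof.
elim: j => // j IHj; rewrite [iter j.+1 y s]iterS.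
have [[k kP]|sP] := first_ascentP (iter j y s); last first.
  by rewrite (df_stranded _ _ yP) // (df_orbit _ _ yP _ sP).
have [Dk _] := kP; have [le_kj|/ltnW le_jk] := leqP k j.
  have Dj : powim j.+1 (iter j x (iter j y s)).
    by rewrite -{1 2}(subnK le_kj) -addnS iterD; apply: powim_iter.
  by rewrite depth_first_ascend // iterS IHj.
rewrite (df_ascent _ _ yP _ k kP).
have -> : k.+1 = j.+1 + (k - j) by rewrite addSn subnKC.
rewrite iterD depth_first_iterK //; apply: depth_first_deep.
by rewrite addnS subnK.
Qed.

End DepthFirst.
End PowerImages.

(** Apply the second relation on the left of [y^(j-i) x^j y^(j-k)], the third
on its right, and reduce [y^j x^j y^j] by the first. *)
Lemma strong_inner_inverse_of_relations (M : monoidType) (x y : M) :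
  (forall j, y ^+ j * x ^+ j * y ^+ j = y ^+ j)%g ->
  (forall i j, i <= j -> x ^+ i * y ^+ j * x ^+ j = y ^+ (j - i) * x ^+ j)%g ->
  (forall j k, k <= j -> x ^+ j * y ^+ j * x ^+ k = x ^+ j * y ^+ (j - k))%g ->
  strong_inner_inverse x y.
Proof.
move=> inner left right i j k le_ij le_kj.
rewrite -left // -[RHS]mulgA -right // !mulgA.
by rewrite -(mulgA _ _ (x ^+ j)%g) -(mulgA _ _ (y ^+ j)%g) inner.
Qed.

Lemma depth_first_strong_inner_inverse (S : Type) (x y : S -> S) (c : S) :
  depth_first x y c -> strong_inner_inverse (x : selfmap S) y.
Proof.
move=> yP; apply: strong_inner_inverse_of_relations.
- move=> j; rewrite !selfmap_expE !selfmap_mulE; apply/funext => s /=.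
  exact: depth_first_inner yP j s.
- move=> i j le_ij; rewrite !selfmap_expE !selfmap_mulE; apply/funext => s /=.
  rewrite -{1}(subnKC le_ij) iterD (depth_first_iterK _ _ _ yP) //.
  by apply: (depth_first_deep _ _ _ yP); rewrite subnK //; exists s.
- move=> j k le_kj; rewrite !selfmap_expE !selfmap_mulE; apply/funext => s /=.
  have -> : iter j y (iter k x s) = iter (j - k) y (iter k y (iter k x s)).
    by rewrite -iterD subnK.
  rewrite -{1 3}(subnKC le_kj).
  apply: (depth_first_iter_kernel _ _ _ yP).
  by apply: (depth_first_iterK _ _ _ yP); exists s.
Qed.

(** The relations with [i = j = k = 1] and with [i = n], [j = k = n.+1]. *)
Lemma strong_inner_inverse_powim (S : Type) (x : S -> S) (y : selfmap S) n s :
  strong_inner_inverse (x : selfmap S) y ->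
  powim x n.+1 s -> x (y s) = s /\ powim x n (y s).
Proof.
move=> sii; have siiE i j k t : i <= j -> k <= j ->
    iter i x (iter j y (iter k x t))
      = iter (j - i) y (iter j x (iter (j - k) y t)).
  move=> le_ij le_kj; have := sii i j k le_ij le_kj.
  by rewrite !selfmap_expE !selfmap_mulE => /(congr1 (fun f => f t)).
move=> [t _ <-]; split; first exact: (siiE 1 1 1 (iter n x t)).
exists (iter n.+1 y (iter n.+1 x t)) => //.
by rewrite siiE // subSnn subnn.
Qed.

Theorem theorem13 (S : Type) (x : S -> S) :
  x @` (\bigcap_(n in [set: nat]) (iter n x @` [set: S]))
    = \bigcap_(n in [set: nat]) (iter n x @` [set: S])
  <-> exists y : selfmap S, strong_inner_inverse (x : selfmap S) y.
Proof.
split=> [xcap|[y sii]].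
  have [[s0]|S0] := pselect (inhabited S).
    have [y [c yP]] := exists_depth_first x s0 xcap.
    by exists y; apply: depth_first_strong_inner_inverse yP.
  (* On the empty set all maps are equal. *)
  exists x => i j k _ _; apply/funext => s.
  by case: S0; exact: (inhabits (s : S)).
apply/seteqP; split=> [_ [s sP <-] n _|s sP].
  apply: (powim_le x (leqnSn n)).
  exact: (powim_iter x n 1 s (sP n I)).
exists (y s); last by have [] := strong_inner_inverse_powim S x y 0 s sii (sP 1 I).
by move=> n _; have [] := strong_inner_inverse_powim S x y n s sii (sP n.+1 I).
Qed.
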